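(* Let $n,p,B\ge 1$ be integers with $B$ dividing $n$, and let $\mathbf{y}=\mathbf{X}\boldsymbol{\beta}_*+\boldsymbol{\eta}$ with $\mathbf{X}\in\mathbb{R}^{n\times p}$, $\boldsymbol{\beta}_*\in\mathbb{R}^p$, $\boldsymbol{\eta}\in\mathbb{R}^n$. Let $\bar{\boldsymbol{\beta}}_k\in\mathbb{R}^p$ be the mean iterate after $k$ epochs of mini-batch gradient descent with random reshuffling, with $B$ mini-batches, step size $\alpha\ge 0$ and initialization $\boldsymbol{\beta}_0\in\mathbb{R}^p$. Let $\widetilde{\mathbf{X}}\in\mathbb{R}^{n\times p}$ be the matrix of modified features, $\mathbf{Z}=\frac1n\widetilde{\mathbf{X}}^{\mathsf T}\mathbf{X}$, and $\mathbf{P}_{\mathbf{Z},0}:=\mathbf{I}-\mathbf{Z}^\dagger\mathbf{Z}$, and assume that $\mathrm{Range}(\widetilde{\mathbf{X}}^{\mathsf T})\subseteq \mathrm{Range}(\widetilde{\mathbf{X}}^{\mathsf T}\mathbf{X})$. If $\mathbf{Z}$ is positive semidefinite and $B\alpha<2/\|n^{-1}\widetilde{\mathbf{X}}^{\mathsf T}\mathbf{X}\|$, then $\bar{\boldsymbol{\beta}}_k\to\bar{\boldsymbol{\beta}}_\infty$ as $k\to\infty$, where $$\bar{\boldsymbol{\beta}}_\infty\equiv\bar{\boldsymbol{\beta}}_\infty(\alpha):=\mathbf{P}_{\mathbf{Z},0}\boldsymbol{\beta}_0+(\widetilde{\mathbf{X}}^{\mathsf T}\mathbf{X})^\dagger\widetilde{\mathbf{X}}^{\mathsf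 T}\mathbf{y}.$$
   Context: $\|\cdot\|$ is the spectral norm, $(\cdot)^\dagger$ the Moore–Penrose pseudoinverse, $\mathrm{Range}(\cdot)$ the column space. Mini-batches: the $n$ rows of $\mathbf{X}$ are partitioned into $B$ fixed groups of size $n/B$, giving $\mathbf{X}_1,\dots,\mathbf{X}_B\in\mathbb{R}^{(n/B)\times p}$; $\mathbf{y}_b$ is the corresponding subvector of $\mathbf{y}$. Put $\mathbf{W}_b:=\frac{B}{n}\mathbf{X}_b^{\mathsf T}\mathbf{X}_b$. Algorithm: in each epoch $k=1,2,\dots$ a permutation $\tau$ is drawn uniformly at random from the set $S_B$ of permutations of $\{1,\dots,B\}$ (independently across epochs), and $$\boldsymbol{\beta}_k^{(b)}=\boldsymbol{\beta}_k^{(b-1)}-\frac{B\alpha}{n}\mathbf{X}_{\tau(b)}^{\mathsf T}\big(\mathbf{X}_{\tau(b)}\boldsymbol{\beta}_k^{(b-1)}-\mathbf{y}_{\tau(b)}\big),\quad b=1,\dots,B,$$ with $\boldsymbol{\beta}_k^{(0)}:=\boldsymbol{\beta}_{k-1}^{(B)}$ and $\boldsymbol{\beta}_0^{(B)}:=\boldsymbol{\beta}_0$. The mean iterate is $\bar{\boldsymbol{\beta}}_k:=\mathbb{E}[\boldsymbol{\beta}_k^{(B)}]$, expectation over the permutations only ($\mathbf{X}$ and $\boldsymbol{\eta}$ held fixed). Modified features: $\Pi_b:=\frac{1}{B!}\sum_{\tau\in S_B}\prod_{j:\,j<\tau^{-1}(b)}(\mathbf{I}-\alpha\mathbf{W}_{\tau(j)})$,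 factors multiplied from right to left in increasing order of $j$, empty product $=\mathbf{I}$; $\widetilde{\mathbf{X}}_b:=\mathbf{X}_b\Pi_b$; $\widetilde{\mathbf{X}}\in\mathbb{R}^{n\times p}$ is the concatenation of the $\widetilde{\mathbf{X}}_b$ with rows placed as in the original partition. $\mathbf{Z}$ is symmetric.
   Formalization: The step size is taken to be α > 0 instead of α ≥ 0: at α = 0 the iterates stay at β₀ and the claim fails (e.g. n = p = B = 1, X = 1, β_* = 0, η = y = 1, β₀ = 0, where the stated limit is 1). *)

(* Defs.v *)
From HB Require Import structures.
From mathcomp Require Import all_boot all_order all_fingroup all_algebra.
From mathcomp Require Import all_classical all_reals all_analysis.

Set Implicit Arguments.
Unset Strict Implicit.
Unset Printing Implicit Defensive.

Import Order.TTheory GRing.Theory Num.Theory.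
Import numFieldNormedType.Exports.

Local Open Scope classical_set_scope.
Local Open Scope ring_scope.

(** * Linear algebra over the reals *)

Definition l2norm (R : realType) (m : nat) (v : 'cV[R]_m) : R :=
  Num.sqrt (\sum_i v i 0 ^+ 2).

Definition spectral_norm (R : realType) (m n : nat) (A : 'M[R]_(m, n)) : R :=
  sup [set l2norm (A *m v) | v in [set v : 'cV[R]_n | l2norm v <= 1]].

(** The column space; MathComp's [(_ <= _)%MS] compares row spaces instead. *)
Definition Range (R : realType) (m n : nat) (A : 'M[R]_(m, n)) :
    set 'cV[R]_m :=
  range (fun v : 'cV[R]_n => A *m v).

(** Symmetry of [A] is not part of this predicate: the matrix it is applied to
    is always symmetric, so symmetry need not be assumed. *)
Definition psd (R : realType) (p : nat) (A : 'M[R]_p) : Prop :=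
  forall v : 'cV[R]_p, 0 <= (v^T *m A *m v) 0 0.

(** The four Penrose conditions. *)
Definition is_moore_penrose (R : realType) (m n : nat)
    (A : 'M[R]_(m, n)) (G : 'M[R]_(n, m)) : Prop :=
  [/\ A *m G *m A = A, G *m A *m G = G,
      (A *m G)^T = A *m G & (G *m A)^T = G *m A].

(** MathComp's [pinvmx] is only a one-sided partial inverse, not the
    Moore-Penrose one.  Existence and uniqueness are [moore_penroseP] and
    [is_moore_penrose_inj] below, so the default value [0] is never used. *)
Definition moore_penrose (R : realType) (m n : nat) (A : 'M[R]_(m, n)) :
    'M[R]_(n, m) :=
  xget 0 [set G | is_moore_penrose A G].

Lemma is_moore_penrose_inj (R : realType) (m n : nat) (A : 'M[R]_(m, n))
    (G H : 'M[R]_(n, m)) :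
  is_moore_penrose A G -> is_moore_penrose A H -> G = H.
Proof.
move=> [G1 G2 G3 G4] [H1 H2 H3 H4].
have AGH : A *m G = A *m H.
  rewrite -G3 -{1}H1 -(mulmxA (A *m H)) trmx_mul G3 H3.
  by rewrite mulmxA G1.
have GHA : G *m A = H *m A.
  rewrite -G4 -{1}H1 -(mulmxA A) mulmxA trmx_mul H4 G4.
  by rewrite -mulmxA (mulmxA A) G1.
by rewrite -G2 GHA -mulmxA AGH mulmxA H2.
Qed.

Lemma mulmxtr_eq0 (R : realType) (m n : nat) (A : 'M[R]_(m, n)) :
  A *m A^T = 0 -> A = 0.
Proof.
move=> AA0; apply/matrixP => i j; rewrite mxE.
have /eqP := congr1 (fun M : 'M[R]_m => M i i) AA0.
rewrite !mxE psumr_eq0 => [/allP/(_ j (mem_index_enum j))/=|k _].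
  by rewrite mxE -expr2 sqrf_eq0 => /eqP.
by rewrite mxE -expr2 sqr_ge0.
Qed.

Lemma row_free_gram_unit (R : realType) (m n : nat) (A : 'M[R]_(m, n)) :
  row_free A -> A *m A^T \in unitmx.
Proof.
move=> freeA; rewrite -row_free_unit -kermx_eq0; apply/eqP.
set K := kermx _; have KA0 : K *m A = 0.
  by apply: mulmxtr_eq0; rewrite trmx_mul mulmxA -(mulmxA K) mulmx_ker mul0mx.
by apply: (row_free_inj freeA); rewrite mul0mx.
Qed.

Lemma moore_penroseP (R : realType) (m n : nat) (A : 'M[R]_(m, n)) :
  is_moore_penrose A (moore_penrose A).
Proof.
apply: (@xgetPex _ 0 [set G | is_moore_penrose A G]).
have : exists r (C : 'M[R]_(m, r)) (D : 'M[R]_(r, n)),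
    [/\ A = C *m D, C^T *m C \in unitmx & D *m D^T \in unitmx].
  exists (\rank A), (col_base A), (row_base A); split.
  - by rewrite mulmx_base.
  - rewrite -{2}[col_base A]trmxK; apply: row_free_gram_unit.
    by rewrite /row_free mxrank_tr; exact: col_base_full.
  - exact/row_free_gram_unit/row_base_free.
move=> [r [C [D [defA uC uD]]]].
set DI := invmx (D *m D^T); set CI := invmx (C^T *m C).
have DIK : D *m D^T *m DI = 1%:M by rewrite mulmxV.
have CIK : CI *m (C^T *m C) = 1%:M by rewrite mulVmx.
have DIT : DI^T = DI by rewrite /DI trmx_inv trmx_mul trmxK.
have CIT : CI^T = CI by rewrite /CI trmx_inv trmx_mul trmxK.
exists (D^T *m DI *m CI *m C^T).
have AG : A *m (D^T *m DI *m CI *m C^T) = C *m CI *m C^T.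
  by rewrite defA !mulmxA -(mulmxA C D) -(mulmxA C) DIK mulmx1.
have GA : D^T *m DI *m CI *m C^T *m A = D^T *m DI *m D.
  by rewrite defA mulmxA -(mulmxA _ C^T) -(mulmxA _ CI) CIK mulmx1.
split.
- by rewrite AG {1}defA mulmxA -(mulmxA _ C^T) -(mulmxA _ CI) CIK mulmx1.
- by rewrite GA !mulmxA -(mulmxA _ D D^T) -(mulmxA _ (D *m _)) DIK mulmx1.
- by rewrite AG !trmx_mul trmxK CIT mulmxA.
- by rewrite GA !trmx_mul trmxK DIT mulmxA.
Qed.

(** * Mini-batches *)

(** A partition of the rows into [B] groups of [n %/ B] rows: row number [i] of
    group [b] is row [row_of (b, i)] of the full matrix, and [pos_of] locates a
    row of the full matrix in its group. *)
Record row_partition (n B : nat) : Type := RowPartition {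
  row_of : 'I_B * 'I_(n %/ B) -> 'I_n;
  pos_of : 'I_n -> 'I_B * 'I_(n %/ B);
  row_ofK : cancel row_of pos_of;
  pos_ofK : cancel pos_of row_of }.

Definition batch (R : realType) (n B q : nat) (part : row_partition n B)
    (M : 'M[R]_(n, q)) (b : 'I_B) : 'M[R]_(n %/ B, q) :=
  rowsub (fun i => row_of part (b, i)) M.

Definition unbatch (R : realType) (n B q : nat) (part : row_partition n B)
    (M : 'I_B -> 'M[R]_(n %/ B, q)) : 'M[R]_(n, q) :=
  \matrix_(r, j) M (pos_of part r).1 (pos_of part r).2 j.

Definition batch_cov (R : realType) (n p B : nat) (part : row_partition n B)
    (X : 'M[R]_(n, p)) (b : 'I_B) : 'M[R]_p :=
  (B%:R / n%:R) *: ((batch part X b)^T *m batch part X b).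

(** * Gradient descent with random reshuffling *)

Definition sgd_step (R : realType) (n p B : nat) (part : row_partition n B)
    (X : 'M[R]_(n, p)) (y : 'cV[R]_n) (alpha : R) (b : 'I_B)
    (beta : 'cV[R]_p) : 'cV[R]_p :=
  beta - (B%:R * alpha / n%:R) *:
    ((batch part X b)^T *m (batch part X b *m beta - batch part y b)).

(** [enum 'I_B] is in increasing order, so the batches [tau 0], [tau 1], ...
    are processed in this order. *)
Definition epoch (R : realType) (n p B : nat) (part : row_partition n B)
    (X : 'M[R]_(n, p)) (y : 'cV[R]_n) (alpha : R) (beta : 'cV[R]_p)
    (tau : {perm 'I_B}) : 'cV[R]_p :=
  foldl (fun beta' b => sgd_step part X y alpha (tau b) beta') beta (enum 'I_B).

(** The iterate after [size taus] epochs, [taus] being the permutations drawn in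
    the successive epochs. *)
Definition iterate (R : realType) (n p B : nat) (part : row_partition n B)
    (X : 'M[R]_(n, p)) (y : 'cV[R]_n) (alpha : R) (beta0 : 'cV[R]_p)
    (taus : seq {perm 'I_B}) : 'cV[R]_p :=
  foldl (epoch part X y alpha) beta0 taus.

Definition uniform_mean (R : realType) (Omega : finType) (V : lmodType R)
    (f : Omega -> V) : V :=
  #|Omega|%:R^-1 *: \sum_w f w.

(** Permutations drawn independently and uniformly in [k] epochs form a uniform
    random element of the [k]-tuples of permutations. *)
Definition mean_iterate (R : realType) (n p B : nat) (part : row_partition n B)
    (X : 'M[R]_(n, p)) (y : 'cV[R]_n) (alpha : R) (beta0 : 'cV[R]_p)
    (k : nat) : 'cV[R]_p :=
  uniform_mean
    (fun taus : k.-tuple {perm 'I_B} => iterate part X y alpha beta0 taus).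

(** * Modified features *)

(** The enumeration is reversed because [\big[mulmx/_]] multiplies from left to
    right, whereas the factor with the smallest [j] is the rightmost one. *)
Definition Pi_mx (R : realType) (n p B : nat) (part : row_partition n B)
    (X : 'M[R]_(n, p)) (alpha : R) (b : 'I_B) : 'M[R]_p :=
  (B`!)%:R^-1 *:
    \sum_(tau : {perm 'I_B})
      \big[mulmx/1%:M]_(j <- rev (enum 'I_B) | (j < (tau^-1)%g b)%N)
        (1%:M - alpha *: batch_cov part X (tau j)).

Definition modified_features (R : realType) (n p B : nat)
    (part : row_partition n B) (X : 'M[R]_(n, p)) (alpha : R) : 'M[R]_(n, p) :=
  unbatch part (fun b => batch part X b *m Pi_mx part X alpha b).

Definition Z_mx (R : realType) (n p B : nat) (part : row_partition n B)
    (X : 'M[R]_(n, p)) (alpha : R) : 'M[R]_p :=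
  n%:R^-1 *: ((modified_features part X alpha)^T *m X).

(** The projection [P_{Z,0}]. *)
Definition null_proj (R : realType) (p : nat) (Z : 'M[R]_p) : 'M[R]_p :=
  1%:M - moore_penrose Z *m Z.

Definition beta_inf (R : realType) (n p B : nat) (part : row_partition n B)
    (X : 'M[R]_(n, p)) (y : 'cV[R]_n) (beta0 : 'cV[R]_p) (alpha : R) :
    'cV[R]_p :=
  let Xt := modified_features part X alpha in
  null_proj (Z_mx part X alpha) *m beta0
    + moore_penrose (Xt^T *m X) *m Xt^T *m y.

(* Main.v *)
(** The gradient steps of an epoch are affine, and telescoping over the batches
    gives [epoch beta tau - beta] as a sum of residual terms
    [X_b^T (X_b beta - y_b)], each multiplied by the factors [1 - alpha W] of
    the batches processed after [b].  Averaging over [tau], and reversing [tau]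
    to exchange "after" with "before", turns these products into [Pi_b^T], so
    the mean epoch is [beta |-> beta - B alpha (Z beta - Xt^T y / n)] and the
    independence of the epochs makes the mean iterate its [k]-fold iterate.
    The same reversal shows that the mean of the full products, [1 - B alpha Z],
    is symmetric.  By the range condition [Xt^T y = Xt^T X v], so it remains to
    see that [(1 - c Z)^k] tends to the projection onto the kernel of [Z] for
    [c = B alpha < 2 / |Z|]; no spectral theorem is needed, as the iterates
    [x_k] of [1 - c Z] satisfy [|x_k|^2 - |x_(k+1)|^2 >= d |Z x_k|^2] with
    [d > 0], whence [(1 - c Z)^k Z x_0 = Z x_k] tends to [0]. *)

Require Import Defs.
From HB Require Import structures.
From mathcomp Require Import all_boot all_order all_fingroup all_algebra.
From mathcomp Require Import all_classical all_reals all_analysis.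
From mathcomp Require Import ring lra.

Set Implicit Arguments.
Unset Strict Implicit.
Unset Printing Implicit Defensive.

Import Order.TTheory GRing.Theory Num.Theory.
Import numFieldNormedType.Exports.

Local Open Scope classical_set_scope.
Local Open Scope ring_scope.

(** * Euclidean inner product and spectral norm *)

Definition dot (R : realType) (m : nat) (u v : 'cV[R]_m) : R :=
  (u^T *m v) 0 0.

Lemma dotC (R : realType) (m : nat) (u v : 'cV[R]_m) : dot u v = dot v u.
Proof. by rewrite /dot -[in LHS](trmxK v) -trmx_mul mxE. Qed.

Lemma dotBl (R : realType) (m : nat) (u v w : 'cV[R]_m) :
  dot (u - v) w = dot u w - dot v w.
Proof. by rewrite /dot linearB mulmxBl !mxE. Qed.

Lemma dotBr (R : realType) (m : nat) (u v w : 'cV[R]_m) :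
  dot u (v - w) = dot u v - dot u w.
Proof. by rewrite !(dotC u) dotBl. Qed.

Lemma dotZl (R : realType) (m : nat) (a : R) (u v : 'cV[R]_m) :
  dot (a *: u) v = a * dot u v.
Proof. by rewrite /dot linearZ /= -scalemxAl mxE. Qed.

Lemma dotZr (R : realType) (m : nat) (a : R) (u v : 'cV[R]_m) :
  dot u (a *: v) = a * dot u v.
Proof. by rewrite dotC dotZl dotC. Qed.

Lemma dot_mulmxr (R : realType) (m n : nat) (A : 'M[R]_(m, n)) u v :
  dot u (A *m v) = dot (A^T *m u) v.
Proof. by rewrite /dot trmx_mul trmxK mulmxA. Qed.

Lemma dotE (R : realType) (m : nat) (v : 'cV[R]_m) :
  dot v v = \sum_i v i 0 ^+ 2.
Proof. by rewrite /dot mxE; apply: eq_bigr => i _; rewrite mxE expr2. Qed.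

Lemma dot_ge0 (R : realType) (m : nat) (v : 'cV[R]_m) : 0 <= dot v v.
Proof. by rewrite dotE sumr_ge0// => i _; rewrite sqr_ge0. Qed.

Lemma sqr_entry_le_dot (R : realType) (m : nat) (v : 'cV[R]_m) (i : 'I_m) :
  v i 0 ^+ 2 <= dot v v.
Proof.
rewrite dotE (bigD1 i)//= lerDl sumr_ge0// => j _; exact: sqr_ge0.
Qed.

Lemma l2normE (R : realType) (m : nat) (v : 'cV[R]_m) :
  l2norm v = Num.sqrt (dot v v).
Proof. by rewrite dotE. Qed.

Lemma l2norm_sqr (R : realType) (m : nat) (v : 'cV[R]_m) :
  l2norm v ^+ 2 = dot v v.
Proof. by rewrite l2normE sqr_sqrtr// dot_ge0. Qed.

Lemma l2norm0 (R : realType) (m : nat) : l2norm (0 : 'cV[R]_m) = 0.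
Proof. by rewrite l2normE /dot mulmx0 mxE sqrtr0. Qed.

Lemma l2normZ (R : realType) (m : nat) (a : R) (v : 'cV[R]_m) :
  l2norm (a *: v) = `|a| * l2norm v.
Proof.
by rewrite !l2normE dotZl dotZr mulrA -expr2 sqrtrM ?sqr_ge0// sqrtr_sqr.
Qed.

(** Needed for [sup] not to fall back on its default value in the spectral norm. Entries of a vector
    in the unit ball are at most 1 in absolute value, so the absolute row sums of [A] bound the
    entries of [A *m v]. *)
Lemma l2norm_image_bounded (R : realType) (m n : nat) (A : 'M[R]_(m, n)) :
  has_ubound [set l2norm (A *m v) | v in [set v : 'cV[R]_n | l2norm v <= 1]].
Proof.
exists (Num.sqrt (\sum_i (\sum_j `|A i j|) ^+ 2)) => _ [v v1 <-].
rewrite /l2norm; apply: ler_wsqrtr; apply: ler_sum => i _.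
rewrite -[X in X <= _]real_normK ?num_real// ler_sqr ?nnegrE//; last first.
  exact: sumr_ge0.
rewrite mxE; apply: le_trans (ler_norm_sum _ _ _) _; apply: ler_sum => j _.
rewrite normrM ler_piMr//.
rewrite -sqrtr_sqr -[leRHS]sqrtr1; apply: ler_wsqrtr.
apply: le_trans (sqr_entry_le_dot v j) _.
by rewrite -l2norm_sqr expr_le1// sqrtr_ge0.
Qed.

Lemma spectral_norm_ge0 (R : realType) (m n : nat) (A : 'M[R]_(m, n)) :
  0 <= spectral_norm A.
Proof.
apply: le_trans (ub_le_sup (l2norm_image_bounded A) _); last first.
  by exists 0 => //=; rewrite l2norm0.
exact: sqrtr_ge0.
Qed.

Lemma l2norm_mulmx_le (R : realType) (m n : nat) (A : 'M[R]_(m, n)) v :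
  l2norm (A *m v) <= spectral_norm A * l2norm v.
Proof.
have [v0|v0] := eqVneq (l2norm v) 0.
  suff -> : v = 0 by rewrite mulmx0 !l2norm0 mulr0.
  apply/matrixP => i j; rewrite ord1 mxE; apply/eqP; rewrite -sqrf_eq0.
  rewrite eq_le sqr_ge0 andbT (le_trans (sqr_entry_le_dot v i))//.
  by rewrite -l2norm_sqr v0 expr0n.
have v_gt0 : 0 < l2norm v by rewrite lt_def v0 sqrtr_ge0.
rewrite -ler_pdivrMr//.
suff <- : l2norm (A *m ((l2norm v)^-1 *: v)) = l2norm (A *m v) / l2norm v.
  apply: ub_le_sup; first exact: l2norm_image_bounded.
  exists ((l2norm v)^-1 *: v) => //=.
  by rewrite l2normZ normfV (gtr0_norm v_gt0) mulVf.
by rewrite -scalemxAr l2normZ normfV (gtr0_norm v_gt0) mulrC.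
Qed.

(** * Richardson iteration for a positive semidefinite matrix *)

(** Expanding [|A v - L v|^2 >= 0] gives [2 L <v, A v> <= |A v|^2 + L^2 |v|^2 <= 2 L^2 |v|^2]; a
    nonzero [L] cancels, and [L = 0] forces [A v = 0]. *)
Lemma dot_mulmx_le (R : realType) (m : nat) (A : 'M[R]_m) v :
  dot v (A *m v) <= spectral_norm A * dot v v.
Proof.
have L0 := spectral_norm_ge0 A; set L := spectral_norm A.
have Av : dot (A *m v) (A *m v) <= L ^+ 2 * dot v v.
  rewrite -!l2norm_sqr -exprMn ler_sqr ?nnegrE ?mulr_ge0 ?sqrtr_ge0//.
  exact: l2norm_mulmx_le.
have := dot_ge0 (A *m v - L *: v).
rewrite dotBl !dotBr !dotZl !dotZr (dotC (A *m v) v) => h.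
have [L_eq0|L_neq0] := eqVneq L 0.
  have Av0 : A *m v = 0.
    apply/matrixP => i j; rewrite ord1 [RHS]mxE; apply/eqP; rewrite -sqrf_eq0.
    rewrite eq_le sqr_ge0 andbT (le_trans (sqr_entry_le_dot _ i))//.
    by rewrite (le_trans Av)// L_eq0 expr0n/= mul0r.
  by rewrite Av0 L_eq0 mul0r /dot mulmx0 mxE.
have L_gt0 : 0 < L by rewrite lt_def L_neq0.
by rewrite -(ler_pM2l L_gt0); nra.
Qed.

(* Positivity of the form at [x - (c / 2) A x] turns the classical expansion of
   |x - c A x|^2 into a decrease by a multiple of |A x|^2. *)
Lemma gradient_step_decrease (R : realType) (m : nat) (A : 'M[R]_m) (c : R)
    (x : 'cV[R]_m) :
  A^T = A -> psd A -> 0 <= c ->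
  c ^+ 2 * (1 - c * spectral_norm A / 2) * dot (A *m x) (A *m x)
    <= dot x x - dot (x - c *: (A *m x)) (x - c *: (A *m x)).
Proof.
move=> Asym Apsd c0.
have := Apsd (x - (c / 2) *: (A *m x)).
rewrite -mulmxA -/(dot _ _) mulmxBr -scalemxAr !dotBl !dotBr !dotZl !dotZr.
rewrite (dot_mulmxr A x (A *m x)) Asym (dotC (A *m x) x).
have := dot_mulmx_le A (A *m x).
set u := dot x (A *m x); set w := dot (A *m x) (A *m x).
set q := dot _ (A *m (A *m x)) => qw h.
(* Positivity times [2 c] reads [2 c u - 2 c^2 w + (c^3 / 2) q >= 0]; this bound on its last term
   gives the claim. *)
have : (c ^+ 3 / 2) * q <= (c ^+ 3 / 2) * (spectral_norm A * w).
  by rewrite ler_wpM2l// divr_ge0// exprn_ge0.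
have : 0 <= 2 * c * (u - c / 2 * w - c / 2 * (w - c / 2 * q)).
  by apply: mulr_ge0; [lra|nra].
nra.
Qed.

(** Entourages of matrices are entrywise, and finitely many eventual conditions hold together
    eventually. *)
Lemma cvg_cV (R : realType) (m : nat) (u : nat -> 'cV[R]_m) (l : 'cV[R]_m) :
  (forall i, (fun k => u k i 0) @ \oo --> l i 0) -> u @ \oo --> l.
Proof.
move=> ul; apply/cvg_mx_entourageP => E entE.
have uE := filter_forall eventually_filter (fun i => cvg_entourage (ul i) entE).
change (\forall k \near \oo, forall i j, (l i j, u k i j) \in E).
apply: (@filterS _ _ eventually_filter _ _ _
  (uE (fun i => fmap_filter _ _))) => k Ek i j.
by rewrite ord1 inE; exact: Ek.
Qed.

Lemma cvg_richardson (R : realType) (m : nat) (A : 'M[R]_m) (c : R)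
    (w : 'cV[R]_m) :
  A^T = A -> psd A -> 0 < c -> c * spectral_norm A < 2 ->
  iter k (fun x => x - c *: (A *m x)) (A *m w) @[k --> \oo] --> (0 : 'cV[R]_m).
Proof.
move=> Asym Apsd c0 cA.
pose x k := iter k (fun x => x - c *: (A *m x)) w.
(* [A] commutes with the step, so it can be moved outside the iteration. *)
have -> : (fun k => iter k (fun x => x - c *: (A *m x)) (A *m w)) =
          (fun k => A *m x k).
  apply/funext; elim=> // k IH.
  by rewrite /= IH /x /= -/(x k) mulmxBr -scalemxAr.
pose d := c ^+ 2 * (1 - c * spectral_norm A / 2).
have d0 : 0 < d by rewrite mulr_gt0 ?exprn_gt0//; lra.
pose a k := dot (x k) (x k).
have decr k : d * dot (A *m x k) (A *m x k) <= a k - a k.+1.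
  exact: gradient_step_decrease (ltW c0).
have a_cvg : cvgn a.
  apply: nonincreasing_is_cvgn.
    apply/nonincreasing_seqP => k; rewrite -subr_ge0 (le_trans _ (decr k))//.
    by rewrite mulr_ge0 ?dot_ge0 ?ltW.
  by exists 0 => _ [k _ <-]; exact: dot_ge0.
have gap : (fun k => d^-1 * (a k - a k.+1)) @ \oo --> (0 : R).
  rewrite -(mulr0 d^-1); apply: cvgMr.
  rewrite -(subrr (limn a)); apply: cvgB => //.
  by rewrite (cvg_shiftS a).
apply: cvg_cV => i; rewrite mxE; apply/norm_cvg0P.
have : (fun k => Num.sqrt (d^-1 * (a k - a k.+1))) @ \oo --> Num.sqrt (0 : R).
  apply: continuous_cvg gap; exact: sqrt_continuous.
rewrite sqrtr0 => gap'.
apply: squeeze_cvgr (cvg_cst 0) gap'; apply: nearW => k.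
rewrite normr_ge0/= -sqrtr_sqr ler_wsqrtr// (le_trans (sqr_entry_le_dot _ i))//.
by rewrite mulrC ler_pdivlMr// mulrC decr.
Qed.

(** * Scaling of the pseudoinverse *)

(** Follows from uniqueness; it relates the pseudoinverse of [Xt^T *m X] to that of [Z]. *)
Lemma moore_penroseZ (R : realType) (m n : nat) (a : R) (A : 'M[R]_(m, n)) :
  a != 0 -> moore_penrose (a *: A) = a^-1 *: moore_penrose A.
Proof.
move=> a0; apply: is_moore_penrose_inj (moore_penroseP _) _.
have [A1 A2 A3 A4] := moore_penroseP A.
split; rewrite -?scalemxAl -?scalemxAr ?scalerA -?scalemxAl ?scalerA.
- by rewrite A1 mulrAC mulfV// mul1r.
- by rewrite A2 -mulrA mulVf// mulr1.
- by rewrite mulfV// scale1r.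
- by rewrite mulVf// scale1r.
Qed.

(** * Composition of the steps of one epoch *)

(** All residuals are taken at the starting point [x], not at the running iterate. Appending a step
    [b] multiplies the previous sum by [1%:M - H b] on the left and adds the residual of [b] at
    [x]. *)
Lemma foldl_affine (R : comPzRingType) (p q N : nat) (H : 'I_N -> 'M[R]_p)
    (h : 'I_N -> 'M[R]_(p, q)) (x : 'M[R]_(p, q)) (s : seq 'I_N) :
  sorted (fun i j : 'I_N => i < j)%N s ->
  foldl (fun x j => x - (H j *m x - h j)) x s =
  x - \sum_(j <- s)
        (\big[mulmx/1%:M]_(i <- rev s | (j < i)%N) (1%:M - H i))
          *m (H j *m x - h j).
Proof.
elim/last_ind: s => [|s b IH]; first by rewrite /= big_nil subr0.
move=> srt; have lt_tr : transitive (fun i j : 'I_N => i < j)%N.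
  by move=> j i k; exact: ltn_trans.
have /andP[sb ss] : all (fun i : 'I_N => i < b)%N s
    && sorted (fun i j : 'I_N => i < j)%N s.
  move: srt; rewrite sorted_pairwise// -cats1 pairwise_cat.
  by rewrite allrel1r -sorted_pairwise//= andbT.
rewrite foldl_rcons IH// big_rcons/= rev_rcons big_cons ltnn.
(* By sortedness no index exceeds the last one, so its product is empty. *)
rewrite [X in _ + X *m _](_ : _ = 1%:M); last first.
  rewrite big_hasC//; apply/hasPn => i; rewrite mem_rev => /(allP sb) ib.
  by rewrite -leqNgt ltnW.
rewrite mul1mx [X in _ = _ - (X + _)](_ : _ = (1%:M - H b) *m \sum_(j <- s)
        (\big[mulmx/1%:M]_(i <- rev s | (j < i)%N) (1%:M - H i))
          *m (H j *m x - h j)); last first.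
  rewrite mulmx_sumr; apply: eq_big_seq => j /(allP sb) jb.
  by rewrite big_cons jb mulmxA.
set S := \sum_(_ <- _) _.
rewrite mulmxBl mul1mx mulmxBr.
move: (H b *m x) (H b *m S) (h b) => u v w.
by apply/matrixP => i j; rewrite !mxE; ring.
Qed.

Lemma foldl_linear (R : comPzRingType) (p q N : nat) (H : 'I_N -> 'M[R]_p)
    (x : 'M[R]_(p, q)) (s : seq 'I_N) :
  foldl (fun x j => x - H j *m x) x s =
  (\big[mulmx/1%:M]_(i <- rev s) (1%:M - H i)) *m x.
Proof.
elim/last_ind: s => [|s b IH]; first by rewrite big_nil mul1mx.
rewrite foldl_rcons IH rev_rcons big_cons -mulmxA.
by rewrite [RHS]mulmxBl mul1mx.
Qed.


HB.instance Definition _ (R : comPzRingType) (p : nat) :=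
  Monoid.isLaw.Build 'M[R]_p 1%:M (@mulmx R p p p)
    (@mulmxA R p p p p) (@mul1mx R p p) (@mulmx1 R p p).

Lemma trmx_big_mulmx (R : comPzRingType) (p : nat) (I : Type) (s : seq I)
    (P : pred I) (M : I -> 'M[R]_p) :
  (\big[mulmx/1%:M]_(i <- s | P i) M i)^T =
  \big[mulmx/1%:M]_(i <- rev s | P i) (M i)^T.
Proof.
elim: s => [|a s IH]; first by rewrite !big_nil trmx1.
rewrite rev_cons big_rcons big_cons /=; case: ifP => _.
  by rewrite trmx_mul IH.
by rewrite IH mulmx1.
Qed.

(** * Reversing the order of the batches *)

Lemma map_rev_ord_enum (N : nat) :
  map (@rev_ord N) (enum 'I_N) = rev (enum 'I_N).
Proof.
apply: (inj_map val_inj).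
rewrite map_rev val_enum_ord -map_comp.
apply: (@eq_from_nth _ 0%N) => [|i]; rewrite size_map ?size_rev ?size_iota
  size_enum_ord// => iN.
rewrite nth_rev size_iota// (nth_map (Ordinal iN)) ?size_enum_ord//=.
by rewrite nth_enum_ord// nth_iota// ltn_subrL (leq_ltn_trans _ iN).
Qed.

Definition rev_perm (N : nat) : {perm 'I_N} := perm (@rev_ord_inj N).

Lemma rev_permE (N : nat) (i : 'I_N) : rev_perm N i = rev_ord i.
Proof. exact: permE. Qed.

(** Transposition reverses a product of symmetric factors, which is the same as visiting the batches
    in reversed order: [(rev_perm N * tau) j] is [tau (rev_ord j)]. *)
Lemma prod_rev_perm (R : comPzRingType) (p N : nat) (M : 'I_N -> 'M[R]_p)
    (P : pred 'I_N) (tau : {perm 'I_N}) :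
  (forall b, (M b)^T = M b) ->
  (\big[mulmx/1%:M]_(j <- rev (enum 'I_N) | P (rev_ord j))
     M (tau j))^T =
  \big[mulmx/1%:M]_(j <- rev (enum 'I_N) | P j) M ((rev_perm N * tau)%g j).
Proof.
move=> Msym; rewrite trmx_big_mulmx revK -[in RHS]map_rev_ord_enum [RHS]big_map.
by apply: eq_big => // j _; rewrite Msym permM rev_permE rev_ordK.
Qed.

(** Left multiplication by [rev_perm N] permutes the summands and exchanges the positions before [b]
    with those after it. *)
Lemma sum_perm_prod_trmx (R : comPzRingType) (p N : nat) (M : 'I_N -> 'M[R]_p)
    (b : 'I_N) :
  (forall b, (M b)^T = M b) ->
  (\sum_(tau : {perm 'I_N}) \big[mulmx/1%:M]_(j <- rev (enum 'I_N)
      | (j < (tau^-1)%g b)%N) M (tau j))^T =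
  \sum_(tau : {perm 'I_N}) \big[mulmx/1%:M]_(j <- rev (enum 'I_N)
      | ((tau^-1)%g b < j)%N) M (tau j).
Proof.
move=> Msym; rewrite raddf_sum [RHS](reindex_inj (mulgI (rev_perm N)))/=.
apply: eq_bigr => tau _; rewrite -prod_rev_perm//; congr (_^T).
apply: eq_bigl => j; rewrite invMg permM.
have -> : ((rev_perm N)^-1)%g ((tau^-1)%g b) = rev_ord ((tau^-1)%g b).
  by apply: (@perm_inj _ (rev_perm N)); rewrite permKV rev_permE rev_ordK.
by rewrite /= ltn_sub2lE// !ltnS.
Qed.

Lemma sum_perm_prod_sym (R : comPzRingType) (p N : nat) (M : 'I_N -> 'M[R]_p) :
  (forall b, (M b)^T = M b) ->
  let S := \sum_(tau : {perm 'I_N})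
             \big[mulmx/1%:M]_(j <- rev (enum 'I_N)) M (tau j) in
  S^T = S.
Proof.
move=> Msym /=; rewrite raddf_sum [RHS](reindex_inj (mulgI (rev_perm N)))/=.
by apply: eq_bigr => tau _; exact: (@prod_rev_perm _ _ _ _ predT).
Qed.

Lemma sorted_enum_ord (N : nat) :
  sorted (fun i j : 'I_N => i < j)%N (enum 'I_N).
Proof. by have := iota_ltn_sorted 0 N; rewrite -val_enum_ord sorted_map. Qed.

Lemma sum_perm_foldl_affine (R : comPzRingType) (p q N : nat)
    (H : 'I_N -> 'M[R]_p) (h : 'I_N -> 'M[R]_(p, q)) (x : 'M[R]_(p, q)) :
  (forall b, (H b)^T = H b) ->
  \sum_(tau : {perm 'I_N})
     foldl (fun x j => x - (H (tau j) *m x - h (tau j))) x (enum 'I_N) =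
  (N`!)%:R *: x - \sum_(b < N)
     (\sum_(tau : {perm 'I_N}) \big[mulmx/1%:M]_(j <- rev (enum 'I_N)
      | (j < (tau^-1)%g b)%N) (1%:M - H (tau j)))^T *m (H b *m x - h b).
Proof.
move=> Hsym.
have Msym b : (1%:M - H b)^T = 1%:M - H b by rewrite raddfB/= trmx1 Hsym.
under eq_bigr => tau _ do
  rewrite (foldl_affine (H \o tau) (h \o tau) _ (sorted_enum_ord N)).
rewrite big_split/= sumrN sumr_const card_Sn -scaler_nat; congr (_ - _).
under [RHS]eq_bigr => b _ do rewrite (sum_perm_prod_trmx b Msym) mulmx_suml.
rewrite [RHS]exchange_big/=; apply: eq_bigr => tau _.
(* Passes from batches [b] to positions [j], with [b = tau j]. *)
rewrite big_enum [RHS](reindex_inj (@perm_inj _ tau))/=.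
by apply: eq_bigr => j _; rewrite permK.
Qed.

(** * Averaging over the permutations of an epoch *)

(** Independence of the epochs enters here: the first draw is split off. [f] takes sequences so that
    one function serves all tuple lengths. *)
Lemma uniform_mean_tuple (R : realType) (T : finType) (V : lmodType R) (k : nat)
    (f : seq T -> V) :
  uniform_mean (fun t : k.+1.-tuple T => f t) =
  uniform_mean (fun a : T => uniform_mean (fun t : k.-tuple T => f (a :: t))).
Proof.
rewrite /uniform_mean -scaler_sumr scalerA !card_tuple expnS natrM invfM.
congr (_ *: _); rewrite pair_bigA/=.
rewrite (reindex (fun u : T * k.-tuple T => [tuple of u.1 :: u.2]))//=.
exists (fun t => (thead t, [tuple of behead t])) => [[a t] _|t _] /=.
  by congr (_, _); apply: val_inj.
by rewrite [RHS]tuple_eta.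
Qed.

Lemma trmx_unbatch_mul (R : realType) (n B q r : nat) (part : row_partition n B)
    (M : 'I_B -> 'M[R]_(n %/ B, q)) (v : 'M[R]_(n, r)) :
  (unbatch part M)^T *m v = \sum_b (M b)^T *m batch part v b.
Proof.
apply/matrixP => i j; rewrite mxE summxE.
under [RHS]eq_bigr => b _ do rewrite mxE.
rewrite pair_bigA/= (reindex (row_of part))/=; last first.
  by exists (pos_of part) => x _; [exact: row_ofK | exact: pos_ofK].
by apply: eq_bigr => -[b k] _; rewrite !mxE row_ofK.
Qed.

Lemma trmx_modified_features_mul (R : realType) (n p B q : nat)
    (part : row_partition n B) (X : 'M[R]_(n, p)) (alpha : R)
    (v : 'M[R]_(n, q)) :
  (modified_features part X alpha)^T *m v =
  \sum_b (Pi_mx part X alpha b)^T *m ((batch part X b)^T *m batch part v b).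
Proof.
rewrite trmx_unbatch_mul; apply: eq_bigr => b _.
by rewrite trmx_mul mulmxA.
Qed.

Lemma batch_mulmx (R : realType) (n B p q : nat) (part : row_partition n B)
    (X : 'M[R]_(n, p)) (v : 'M[R]_(p, q)) (b : 'I_B) :
  batch part (X *m v) b = batch part X b *m v.
Proof.
by apply/matrixP => i j; rewrite !mxE; apply: eq_bigr => k _; rewrite mxE.
Qed.

Lemma batchB (R : realType) (n B p : nat) (part : row_partition n B)
    (u v : 'M[R]_(n, p)) (b : 'I_B) :
  batch part (u - v) b = batch part u b - batch part v b.
Proof. by apply/matrixP => i j; rewrite !mxE. Qed.

Lemma batch_cov_sym (R : realType) (n p B : nat) (part : row_partition n B)
    (X : 'M[R]_(n, p)) (b : 'I_B) :
  (batch_cov part X b)^T = batch_cov part X b.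
Proof. by rewrite /batch_cov linearZ/= trmx_mul trmxK. Qed.

Lemma fact_neq0 (R : realType) (B : nat) : (B`!)%:R != 0 :> R.
Proof. by rewrite pnatr_eq0 -lt0n fact_gt0. Qed.

(** Stated for [q] columns so that it covers both the actual epoch and the choice [x = 1%:M],
    [y = 0], which yields the mean of the full products. *)
Lemma mean_sgd_epoch (R : realType) (n p B q : nat) (part : row_partition n B)
    (X : 'M[R]_(n, p)) (y : 'M[R]_(n, q)) (alpha : R) (x : 'M[R]_(p, q)) :
  (B`!)%:R^-1 *: \sum_(tau : {perm 'I_B})
    foldl (fun x j => x - ((alpha *: batch_cov part X (tau j)) *m x
             - (B%:R * alpha / n%:R) *:
                 ((batch part X (tau j))^T *m batch part y (tau j))))
          x (enum 'I_B)
  = x - (B%:R * alpha / n%:R) *: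
      ((modified_features part X alpha)^T *m (X *m x - y)).
Proof.
have Hsym b : (alpha *: batch_cov part X b)^T = alpha *: batch_cov part X b.
  by rewrite linearZ/= batch_cov_sym.
rewrite (sum_perm_foldl_affine (fun b => (B%:R * alpha / n%:R) *:
  ((batch part X b)^T *m batch part y b)) x Hsym).
rewrite scalerBr scalerA mulVf ?fact_neq0// scale1r; congr (_ - _).
rewrite trmx_modified_features_mul !scaler_sumr; apply: eq_bigr => b _.
rewrite [LHS]scalemxAl [RHS]scalemxAr; congr (_ *m _); first by rewrite linearZ.
rewrite batchB batch_mulmx mulmxBr scalerBr mulmxA /batch_cov scalerA.
rewrite -scalemxAl.
by congr (_ *: _ - _); ring.
Qed.

Lemma mean_epoch (R : realType) (n p B : nat) (part : row_partition n B)
    (X : 'M[R]_(n, p)) (y : 'cV[R]_n) (alpha : R) (beta : 'cV[R]_p) :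
  uniform_mean (epoch part X y alpha beta) =
  beta - (B%:R * alpha / n%:R) *:
    ((modified_features part X alpha)^T *m (X *m beta - y)).
Proof.
rewrite -mean_sgd_epoch /uniform_mean card_Sn; congr (_ *: _).
apply: eq_bigr => tau _; rewrite /epoch; congr foldl.
apply/funext => x; apply/funext => b; rewrite /sgd_step; congr (_ - _).
rewrite mulmxBr scalerBr mulmxA /batch_cov scalerA -scalemxAl.
by congr (_ *: _ - _); ring.
Qed.

(** The mean of the full products is [1 - B alpha Z], and it is invariant under transposition by
    reversal; the nonzero factor [B alpha] is then cancelled. *)
Lemma Z_mx_sym (R : realType) (n p B : nat) (part : row_partition n B)
    (X : 'M[R]_(n, p)) (alpha : R) :
  B%:R * alpha != 0 -> (Z_mx part X alpha)^T = Z_mx part X alpha.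
Proof.
move=> Ba0.
have := mean_sgd_epoch part X (0 : 'M[R]_(n, p)) alpha 1%:M.
rewrite (eq_bigr (fun tau : {perm 'I_B} =>
  \big[mulmx/1%:M]_(j <- rev (enum 'I_B))
    (1%:M - alpha *: batch_cov part X (tau j)))) => [|tau _]; last first.
  rewrite -[RHS]mulmx1.
  rewrite -(foldl_linear (fun j => alpha *: batch_cov part X (tau j))).
  congr foldl; apply/funext => x; apply/funext => b.
  rewrite [batch part 0 _](_ : _ = 0) ?mulmx0 ?scaler0 ?subr0//.
  by apply/matrixP => i j; rewrite !mxE.
rewrite mulmx1 subr0 -scalerA -/(Z_mx part X alpha) => E.
have Msym b : (1%:M - alpha *: batch_cov part X b)^T =
              1%:M - alpha *: batch_cov part X b.
  by rewrite linearB linearZ/= trmx1 batch_cov_sym.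
have := congr1 trmx E; rewrite linearZ/= (sum_perm_prod_sym Msym) E.
rewrite linearB/= trmx1 => /addrI/oppr_inj.
by rewrite [in X in _ = X -> _]linearZ/= => /(scalerI Ba0)/esym.
Qed.

(** * The mean iterate in closed form *)

Lemma uniform_mean_affine (R : realType) (T : finType) (p q : nat)
    (A : 'M[R]_(p, q)) (c : 'cV[R]_p) (f : T -> 'cV[R]_q) :
  (0 < #|T|)%N ->
  uniform_mean (fun t => c + A *m f t) = c + A *m uniform_mean f.
Proof.
move=> T0; rewrite /uniform_mean big_split/= sumr_const.
rewrite -(scaler_nat _ c) scalerDr scalerA mulVf ?pnatr_eq0 -?lt0n//.
rewrite scale1r; congr (_ + _).
by rewrite -mulmx_sumr scalemxAr.
Qed.

Lemma mean_iterateS (R : realType) (n p B : nat) (part : row_partition n B)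
    (X : 'M[R]_(n, p)) (y : 'cV[R]_n) (alpha : R) (beta : 'cV[R]_p) (k : nat) :
  mean_iterate part X y alpha beta k.+1 =
  uniform_mean (fun tau =>
    mean_iterate part X y alpha (epoch part X y alpha beta tau) k).
Proof. exact: (uniform_mean_tuple k (iterate part X y alpha beta)). Qed.

(** [v] solves the averaged normal equations, hence is fixed by the mean epoch, and the error
    [beta - v] evolves linearly. The induction is uniform in [beta] because the first epoch changes
    the starting point. *)
Lemma mean_iterateE (R : realType) (n p B : nat) (part : row_partition n B)
    (X : 'M[R]_(n, p)) (y : 'cV[R]_n) (alpha : R) (v : 'cV[R]_p) :
  (modified_features part X alpha)^T *m y
    = (modified_features part X alpha)^T *m X *m v ->
  forall k beta, mean_iterate part X y alpha beta k =
  v + iter k (fun u => u - (B%:R * alpha) *: (Z_mx part X alpha *m u))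
        (beta - v).
Proof.
move=> yv; set F := fun u => u - (B%:R * alpha) *: (Z_mx part X alpha *m u).
have FE u : F u = (1%:M - (B%:R * alpha) *: Z_mx part X alpha) *m u.
  by rewrite [RHS]mulmxBl mul1mx -(scalemxAl _ (Z_mx _ _ _)).
elim=> [|k IH] beta.
  rewrite /mean_iterate /uniform_mean card_tuple expn0 invr1 scale1r.
  rewrite (big_pred1 [tuple]) => [|t]; last by apply/esym/eqP; exact: tuple0.
  by rewrite /iterate /= addrC subrK.
(* Linearity of the [k]-fold map lets the mean over the first epoch pass through it. *)
have [M iterE] : exists M : 'M[R]_p, forall u, iter k F u = M *m u.
  elim: k {IH} => [|k [M IH]].
    by exists 1%:M => u; rewrite mul1mx.
  exists ((1%:M - (B%:R * alpha) *: Z_mx part X alpha) *m M) => u.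
  by rewrite iterS IH FE mulmxA.
rewrite mean_iterateS.
have -> : (fun tau =>
      mean_iterate part X y alpha (epoch part X y alpha beta tau) k) =
    (fun tau => (v - M *m v) + M *m epoch part X y alpha beta tau).
  by apply/funext => tau; rewrite IH iterE mulmxBr -addrA [- _ + _]addrC.
rewrite uniform_mean_affine ?card_Sn ?fact_gt0// mean_epoch.
rewrite iterSr iterE -addrA -mulmxN -mulmxDr; congr (_ + _ *m _).
rewrite addrC /F mulmxBr yv -mulmxA -mulmxBr -mulmxBr /Z_mx.
by rewrite -scalemxAl scalerA -mulmxA addrAC.
Qed.

(** * Limit of the mean iterates *)

Lemma richardson_iterD_ker (R : realType) (m : nat) (A : 'M[R]_m) (c : R)
    (u w : 'cV[R]_m) (k : nat) :
  A *m u = 0 ->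
  iter k (fun x => x - c *: (A *m x)) (u + w) =
  u + iter k (fun x => x - c *: (A *m x)) w.
Proof.
by move=> Au; elim: k => //= k ->; rewrite mulmxDr Au add0r addrA.
Qed.

Lemma cvg_richardson_null_proj (R : realType) (m : nat) (A : 'M[R]_m) (c : R)
    (u : 'cV[R]_m) :
  A^T = A -> psd A -> 0 < c -> c * spectral_norm A < 2 ->
  iter k (fun x => x - c *: (A *m x)) u @[k --> \oo] --> null_proj A *m u.
Proof.
move=> Asym Apsd c0 cA; have [A1 _ _ A4] := moore_penroseP A.
have AP0 : A *m (null_proj A *m u) = 0.
  by rewrite mulmxA mulmxBr mulmx1 mulmxA A1 subrr mul0mx.
(* Kernel part plus range part: by symmetry the projection [moore_penrose A *m A] equals
   [A *m (moore_penrose A)^T]. The iteration fixes the first part and sends the second to 0. *)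
have uE : u = null_proj A *m u + A *m ((moore_penrose A)^T *m u).
  by rewrite mulmxA -{2}Asym -trmx_mul A4 -mulmxDl subrK mul1mx.
have -> : (fun k => iter k (fun x => x - c *: (A *m x)) u) =
    (fun k => null_proj A *m u + iter k (fun x => x - c *: (A *m x))
       (A *m ((moore_penrose A)^T *m u))).
  by apply/funext => k; rewrite {1}uE richardson_iterD_ker.
suff : null_proj A *m u + iter k (fun x => x - c *: (A *m x))
    (A *m ((moore_penrose A)^T *m u)) @[k --> \oo] --> null_proj A *m u + 0.
  by rewrite addr0.
apply: cvgD; first exact: cvg_cst.
exact: cvg_richardson.
Qed.

Theorem corollary3p5 (R : realType) (n p B : nat)
    (n_ge1 : (1 <= n)%N) (p_ge1 : (1 <= p)%N) (B_ge1 : (1 <= B)%N)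
    (B_dvd_n : (B %| n)%N)
    (part : row_partition n B)
    (X : 'M[R]_(n, p)) (beta_star : 'cV[R]_p) (eta y : 'cV[R]_n)
    (y_def : y = X *m beta_star + eta)
    (* the claim fails for alpha = 0, where the iterates stay at beta0 *)
    (alpha : R) (alpha_gt0 : 0 < alpha) (beta0 : 'cV[R]_p)
    (range_sub :
       Range (modified_features part X alpha)^T
         `<=` Range ((modified_features part X alpha)^T *m X))
    (Z_psd : psd (Z_mx part X alpha))
    (* division in the extended reals, so the bound is +oo when Z = 0 *)
    (alpha_lt : ((B%:R * alpha)%:E
                  < 2%:E / (spectral_norm (Z_mx part X alpha))%:E)%E) :
  mean_iterate part X y alpha beta0 k @[k --> \oo]
    --> beta_inf part X y beta0 alpha.
Proof.
set c := B%:R * alpha; set Z := Z_mx part X alpha.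
set Xt := modified_features part X alpha.
have c_gt0 : 0 < c by rewrite mulr_gt0// ltr0n.
have n_neq0 : n%:R != 0 :> R by rewrite pnatr_eq0 -lt0n.
have Zsym : Z^T = Z by apply: Z_mx_sym; rewrite gt_eqF.
have XtXE : Xt^T *m X = n%:R *: Z by rewrite scalerA mulfV// scale1r.
have cZ : c * spectral_norm Z < 2.
  (* For norm 0 the real inequality is trivial; otherwise the extended quotient is a real one. *)
  have := spectral_norm_ge0 Z; rewrite le_eqVlt => /predU1P[<-|Z_gt0].
    by rewrite mulr0.
  move: alpha_lt; rewrite -/c -/Z inver gt_eqF// -EFinM lte_fin.
  by rewrite ltr_pdivlMr.
have [v _ vE] : Range (Xt^T *m X) (Xt^T *m y) by apply: range_sub; exists y.
(* With [Xt^T y = Xt^T X v], the second term of the limit is [moore_penrose Z *m Z *m v], that is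
   [v - null_proj Z *m v]. *)
have -> : beta_inf part X y beta0 alpha = v + null_proj Z *m (beta0 - v).
  rewrite /beta_inf -/Z -/Xt -mulmxA -vE XtXE moore_penroseZ//.
  rewrite -scalemxAl -scalemxAl -scalemxAr scalerA mulVf// scale1r mulmxBr.
  rewrite [null_proj Z *m v]mulmxBl mul1mx opprB.
  by rewrite [RHS]addrC -addrA subrK mulmxA.
under eq_fun => k do rewrite (mean_iterateE (esym vE)).
by apply: cvgD; [exact: cvg_cst | exact: cvg_richardson_null_proj].
Qed.
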